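(* Let $\pi\in\mathfrak{S}_n$. (a) If $y\in\mathrm{Rix}(\pi)$, then either $y$ is a double ascent of $\pi$, or $y$ is the rightmost valley of $\pi$ and $y$ is either the first letter of $\pi$ or immediately follows a peak of $\pi$. (b) Let $y$ be a letter of $\pi$ that is either a double ascent of $\pi$, or is the rightmost valley of $\pi$ and is either the first letter of $\pi$ or immediately follows a peak of $\pi$. Then $y\in\mathrm{Rix}(\pi)$ if and only if none of $y+1,y+2,\dots,n$ is immediately to the right of the maximal descending ridge of $\pi$ or appears as a peak of $\pi$ to the right of $y$.
   Context: Permutations $\pi=\pi_1\cdots\pi_n$ are in one-line notation with $\pi_0=\pi_{n+1}=\infty$. A letter $\pi_i$ is a descent if $\pi_i>\pi_{i+1}$ (for $i\in[n-1]$), an ascent otherwise; a peak if $\pi_{i-1}<\pi_i>\pi_{i+1}$, a valley if $\pi_{i-1}>\pi_i<\pi_{i+1}$, a double ascent if $\pi_{i-1}<\pi_i<\pi_{i+1}$, a double descent if $\pi_{i-1}>\pi_i>\pi_{i+1}$. Rix-factorization $\pi=\alpha_1\cdots\alpha_k\beta$: (1) $w:=\pi$, $i:=0$; (2) if $w$ is increasing, $\beta:=w$, stop; else $i:=i+1$, let $x$ be the largest descent of the word $w$, write $w=w'xw''$; (3) if $w'$ empty, $\beta:=w$, stop; else $\alpha_i:=w'x$, $w:=w''$, go to (2). $\beta_1(\pi)$ is the first letter of $\beta$. A rixed point of $\pi$ is a letter in the maximal increasing suffix of $\pi$ not smaller than $\beta_1(\pi)$; $\mathrm{Rix}(\pi)$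 is their set. A descent $y$ of $\pi$ is a leading descent if no larger descent of $\pi$ appears after $y$. Maximal descending ridge: prepend $\infty$ to $\pi$ and regard $\infty$ as the first leading descent of $\infty\pi$. If some two leading descents of $\infty\pi$ occupy adjacent positions, and $\pi_i,\pi_{i+1}$ (with $\pi_0=\infty$ allowed) is the leftmost such pair, the ridge is the prefix of $\infty\pi$ ending with $\pi_i$; otherwise the ridge is the prefix of $\infty\pi$ ending with the rightmost descent of $\pi$ (it is just $\infty$ if $\pi$ has no descent). ''Immediately to the right of the ridge'' refers to the letter of $\pi$ directly following the ridge's last letter. *)

(* Defs.v *)
(* MathComp. *)
From mathcomp Require Import all_boot perm.

Set Implicit Arguments.
Unset Strict Implicit.
Unset Printing Implicit Defensive.

(* Words are sequences of naturals, assumed to have distinct letters, so that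
   a letter y of w determines its position: [index y w] is its 0-based one.
   The letter "infinity" is encoded as [None] in [option nat]. *)

Definition one_line (n : nat) (p : 'S_n) : seq nat :=
  [seq (p i : nat).+1 | i <- enum 'I_n].

Definition ltx (a b : option nat) : bool :=
  match a, b with
  | Some x, Some y => x < y
  | Some _, None => true
  | None, _ => false
  end.

Definition inf_cons (w : seq nat) : seq (option nat) := None :: map Some w.

(* The letter w_i for 0 <= i <= n + 1, where n = size w; the default value of
   [nth] gives the convention at i = n + 1. *)
Definition letter (w : seq nat) (i : nat) : option nat :=
  nth None (inf_cons w) i.

(* The neighbours of the letter y, whose 1-based position is
   [(index y w).+1]. *)
Definition prev_letter (w : seq nat) (y : nat) := letter w (index y w).
Definition next_letter (w : seq nat) (y : nat) := letter w (index y w).+2.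

(* The last letter of w is never a descent, being followed by infinity. *)
Definition descent (w : seq nat) (y : nat) : bool :=
  (y \in w) && ltx (next_letter w y) (Some y).

Definition peak (w : seq nat) (y : nat) : bool :=
  [&& y \in w, ltx (prev_letter w y) (Some y) & ltx (next_letter w y) (Some y)].

Definition valley (w : seq nat) (y : nat) : bool :=
  [&& y \in w, ltx (Some y) (prev_letter w y) & ltx (Some y) (next_letter w y)].

Definition double_ascent (w : seq nat) (y : nat) : bool :=
  [&& y \in w, ltx (prev_letter w y) (Some y) & ltx (Some y) (next_letter w y)].

Definition rightmost_valley (w : seq nat) (y : nat) : Prop :=
  valley w y /\ forall z, valley w z -> index z w <= index y w.

Definition first_letter (w : seq nat) (y : nat) : Prop := ohead w = Some y.

Definition follows_peak (w : seq nat) (y : nat) : Prop :=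
  exists2 z, prev_letter w y = Some z & peak w z.

Definition largest_descent (w : seq nat) : nat :=
  \max_(x <- w | descent w x) x.

(* The pair of the factors [:: alpha_1; ...; alpha_k] and of beta. The number k
   of steps left only ensures termination: see rix_factorizationE. *)
Fixpoint rix_rec (k : nat) (w : seq nat) : seq (seq nat) * seq nat :=
  if k is k'.+1 then
    if sorted ltn w then ([::], w) else
    let x := largest_descent w in
    let w' := take (index x w) w in
    let w'' := drop (index x w).+1 w in
    if w' == [::] then ([::], w) else
    let: (alphas, beta) := rix_rec k' w'' in (rcons w' x :: alphas, beta)
  else ([::], w).

Definition rix_factorization (w : seq nat) := rix_rec (size w) w.

Lemma rix_factorizationE (w : seq nat) :
  rix_factorization w =
    if sorted ltn w then ([::], w) else
    let x := largest_descent w in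
    let w' := take (index x w) w in
    let w'' := drop (index x w).+1 w in
    if w' == [::] then ([::], w) else
    let: (alphas, beta) := rix_factorization w'' in
    (rcons w' x :: alphas, beta).
Proof.
have fuel k1 k2 v : size v <= k1 -> size v <= k2 -> rix_rec k1 v = rix_rec k2 v.
  elim: k1 k2 v => [|k1 IH] [|k2] v //=.
  - by rewrite leqn0 => /nilP-> _.
  - by rewrite leqn0 => _ /nilP->.
  move=> le1 le2; case: ifP => // _; case: ifP => // _.
  have le_drop m i : size v <= m.+1 -> size (drop i.+1 v) <= m.
    move=> le_m; rewrite size_drop leq_subLR; apply: leq_trans le_m _.
    by rewrite addSn ltnS leq_addl.
  by rewrite (IH k2) ?le_drop.
rewrite /rix_factorization; case: w => [|a w] //=.
case: ifP => // _; case: ifP => // _.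
by rewrite (fuel _ (size (drop (index (largest_descent (a :: w)) (a :: w)) w)))
  // size_drop leq_subr.
Qed.

(* The default value 0 is relevant only for the empty word. *)
Definition beta1 (w : seq nat) : nat := head 0 (rix_factorization w).2.

Fixpoint max_incr_suffix (w : seq nat) : seq nat :=
  if w is _ :: w' then
    if sorted ltn w then w else max_incr_suffix w'
  else [::].

Definition Rix (w : seq nat) : seq nat :=
  [seq y <- max_incr_suffix w | beta1 w <= y].

(* The leading descents of the word infinity w. *)
Definition leading_descent (w : seq nat) (a : option nat) : bool :=
  if a is Some y then
    descent w y &&
      all (fun z => descent w z ==> (z <= y)) (drop (index y w).+1 w)
  else true.

Definition adjacent_leading (w : seq nat) (i : nat) : bool :=
  leading_descent w (letter w i) && leading_descent w (letter w i.+1).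

(* The 1-based position of the rightmost descent, 0 if there is none. *)
Definition rightmost_descent_pos (w : seq nat) : nat :=
  \max_(y <- w | descent w y) (index y w).+1.

(* The two letters of the pair i are in infinity w iff i < size w; [find]
   returns the leftmost such pair. *)
Definition ridge (w : seq nat) : seq (option nat) :=
  let pairs := iota 0 (size w) in
  if has (adjacent_leading w) pairs
  then take (find (adjacent_leading w) pairs).+1 (inf_cons w)
  else take (rightmost_descent_pos w).+1 (inf_cons w).

Definition right_of_ridge (w : seq nat) (z : nat) : Prop :=
  letter w (size (ridge w)) = Some z.

(* Main.v *)
(* Each factor alpha_i of the Rix-factorization ends in the i-th leading descent,
   and the factorization stops before the last descent exactly when two leading
   descents of (infinity pi) are adjacent. Hence the letter immediately to the
   right of the maximal descending ridge is beta_1, and the theorem reduces to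
   comparing y with beta_1: any y followed by a larger letter either has a larger
   peak to its right or lies in the maximal increasing suffix. *)
Require Import Defs.
From mathcomp Require Import all_boot perm.

Set Implicit Arguments.
Unset Strict Implicit.
Unset Printing Implicit Defensive.

(** * Letters, neighbours and descents in concatenated words *)

(** The index is a successor because [letter v 0] is infinity, a place that the last letter of a
    nonempty [u] takes in [u ++ v]. *)
Lemma letter_cat (u v : seq nat) (j : nat) :
  letter (u ++ v) (size u + j.+1) = letter v j.+1.
Proof.
by rewrite /letter /inf_cons addnS /= map_cat nth_cat size_map ltnNge leq_addr
  addKn.
Qed.

Lemma letterS (w : seq nat) (j : nat) :
  j < size w -> letter w j.+1 = Some (nth 0 w j).
Proof. by move=> lt_j; rewrite /letter /= (nth_map 0). Qed.

Lemma index_split (a b : seq nat) (y : nat) :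
  y \notin a -> index y (a ++ y :: b) = size a.
Proof. by move=> /negbTE ya; rewrite index_cat ya /= eqxx addn0. Qed.

Lemma prev_letter_split (a b : seq nat) (y : nat) : y \notin a ->
  prev_letter (a ++ y :: b) y = last None (map Some a).
Proof.
move=> ya; rewrite /prev_letter index_split // /letter /inf_cons map_cat.
by rewrite -cat_cons nth_cat /= size_map leqnn -[size a](size_map Some) nth_last.
Qed.

Lemma next_letter_split (a b : seq nat) (y : nat) : y \notin a ->
  next_letter (a ++ y :: b) y = ohead b.
Proof.
move=> ya; rewrite /next_letter index_split //.
by rewrite -[(size a).+2]addn2 letter_cat; case: b.
Qed.

Lemma uniq_split (a b : seq nat) (y : nat) :
  uniq (a ++ y :: b) -> y \notin a.
Proof. by rewrite cat_uniq => /and3P[_ /= /norP[]]. Qed.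

Lemma uniq_splitr (a b : seq nat) (y : nat) :
  uniq (a ++ y :: b) -> y \notin b.
Proof. by rewrite cat_uniq /= => /and4P[]. Qed.

Lemma descent_split (a b : seq nat) (y : nat) : y \notin a ->
  descent (a ++ y :: b) y = ltx (ohead b) (Some y).
Proof.
by move=> ya; rewrite /descent next_letter_split // mem_cat mem_head orbT.
Qed.

(** Only a letter and its successor matter, and prepending [u] changes neither. *)
Lemma descent_cat (u v : seq nat) (y : nat) :
  uniq (u ++ v) -> y \in v -> descent (u ++ v) y = descent v y.
Proof.
move=> Uuv /splitPr yv; case: yv Uuv => v1 v2 Uuv.
rewrite catA descent_split ?descent_split //.
  by move: Uuv; rewrite cat_uniq => /and3P[_ _ /uniq_split].
by move: Uuv; rewrite catA => /uniq_split.
Qed.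

Lemma descent_mem (w : seq nat) (y : nat) : descent w y -> y \in w.
Proof. by case/andP. Qed.

Lemma leading_descent_cat (u v : seq nat) (y : nat) :
  uniq (u ++ v) -> y \in v ->
  leading_descent (u ++ v) (Some y) = leading_descent v (Some y).
Proof.
move=> Uuv yv; rewrite /leading_descent descent_cat //; congr (_ && _).
have yu : (y \in u) = false.
  apply/negP => yu; move: Uuv; rewrite cat_uniq => /and3P[_ /hasP[]].
  by exists y.
rewrite index_cat yu -addnS drop_cat ltnNge leq_addr addKn /=.
by apply: eq_in_all => z /mem_drop zv; rewrite descent_cat.
Qed.

Lemma sorted_no_descent (w : seq nat) (y : nat) :
  uniq w -> sorted ltn w -> descent w y = false.
Proof.
move=> Uw Sw; apply/negP => dy; have yw := descent_mem dy.
case/splitPr: yw Uw Sw dy => a [|c b] Uw; rewrite descent_split ?(uniq_split Uw) //.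
rewrite sorted_cat_cons /= => /and3P[_ lt_yc _] /(ltn_trans lt_yc).
by rewrite ltnn.
Qed.

Lemma unsorted_descent (w : seq nat) : uniq w -> ~~ sorted ltn w ->
  exists a x c b, w = a ++ [:: x, c & b] /\ c < x.
Proof.
elim: w => [|x [|c b] IH] //= /andP[xcb Ucb].
rewrite negb_and -leqNgt leq_eqVlt => /orP[/orP[/eqP cx|lt_cx]|nS].
- by rewrite cx mem_head in xcb.
- by exists [::], x, c, b.
by have [a [x' [c' [b' [-> lt_cx]]]]] := IH Ucb nS; exists (x :: a), x', c', b'.
Qed.

(** * The largest descent and induction along the factorization *)

Lemma bigmax_attained (I : eqType) (r : seq I) (P : pred I) (F : I -> nat) :
  \max_(i <- r | P i) F i = 0 \/
  exists2 i, (i \in r) && P i & \max_(i <- r | P i) F i = F i.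
Proof.
rewrite big_seq_cond.
apply: (big_ind (fun m => m = 0 \/ exists2 i, (i \in r) && P i & m = F i)).
- by left.
- by move=> m1 m2 K1 K2; rewrite /maxn; case: ifP.
- by move=> i Pi; right; exists i.
Qed.

Lemma largest_descent_ge (w : seq nat) (z : nat) :
  descent w z -> z <= largest_descent w.
Proof.
by move=> dz; apply: (@leq_bigmax_seq _ _ _ id) => //; apply: descent_mem.
Qed.

Lemma largest_descent_split (w : seq nat) : uniq w -> ~~ sorted ltn w ->
  exists a c b, w = a ++ [:: largest_descent w, c & b]
    /\ c < largest_descent w.
Proof.
move=> Uw /(unsorted_descent Uw)[a [x [c [b [wE lt_cx]]]]].
have dx : descent w x.
  by rewrite wE descent_split //; move: Uw; rewrite wE => /uniq_split.
have dL : descent w (largest_descent w).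
  (* The default 0 of the maximum is excluded: the descent [x] exceeds [c], so it is positive. *)
  case: (bigmax_attained w (descent w) id) => [L0|[i /andP[_ di] iE]].
    move: (largest_descent_ge dx); rewrite /largest_descent L0.
    by move: lt_cx; case: (x).
  by rewrite /largest_descent iE.
move: (largest_descent w) dL (descent_mem dL) => L dL Lw.
case/splitPr: Lw Uw dL {wE dx} => a' b' Uw.
rewrite descent_split ?(uniq_split Uw) //.
by case: b' Uw => // c' b' _ lt_c; exists a', c', b'.
Qed.

(** One case for each branch of the algorithm: [w] is increasing, its largest descent comes first,
    or a factor [rcons a x] is split off. The first two stop with [w] as beta; the third passes beta
    on to the suffix [c :: b], nonempty since a descent is never the last letter. *)
Lemma rix_ind (P : seq nat -> Prop) :
  (forall w, uniq w -> sorted ltn w -> beta1 w = head 0 w -> P w) ->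
  (forall x c b, let w := [:: x, c & b] in uniq w -> c < x ->
     (forall z, descent w z -> z <= x) -> beta1 w = x -> P w) ->
  (forall a x c b, let w := a ++ [:: x, c & b] in uniq w -> c < x ->
     (forall z, descent w z -> z <= x) -> a != [::] ->
     beta1 w = beta1 (c :: b) -> P (c :: b) -> P w) ->
  forall w, uniq w -> P w.
Proof.
move=> Psorted Phead Pcat w; have [k] := ubnP (size w).
elim: k w => // k IH w lt_w_k Uw; have := rix_factorizationE w.
case: ifPn => [Sw fE|nSw]; first by apply: Psorted; rewrite // /beta1 fE.
have := @largest_descent_ge w.
have [a [c [b [+ +]]]] := largest_descent_split Uw nSw.
move: (largest_descent w) => x wE lt_cx max_x.
rewrite {}wE in lt_w_k Uw {nSw} max_x *.
rewrite /= index_split ?(uniq_split Uw) // take_size_cat //.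
rewrite -cat_rcons drop_size_cat ?size_rcons // cat_rcons.
case: a => [|h a] in lt_w_k Uw max_x *.
  by move=> fE; apply: Phead; rewrite // /beta1 fE.
rewrite /= => fE; apply: (Pcat (h :: a)) => //.
  by rewrite /beta1 /= fE; case: (rix_factorization (c :: b)).
apply: IH; last by move: Uw; rewrite -cat_rcons cat_uniq => /and3P[].
rewrite -ltnS (leq_trans _ lt_w_k) //= size_cat /= !addnS !ltnS.
by rewrite (leq_trans (leq_addl (size a) _)) ?leqW.
Qed.

Lemma beta1_mem (w : seq nat) : uniq w -> w != [::] -> beta1 w \in w.
Proof.
move=> Uw; elim/rix_ind: w / Uw.
- by case=> //= x w _ _ -> _; rewrite mem_head.
- by move=> x c b w _ _ _ -> _; rewrite mem_head.
move=> a x c b w _ _ _ _ -> /(_ isT) IH _.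
by rewrite /w mem_cat in_cons IH !orbT.
Qed.

(** * The maximal descending ridge and beta_1 *)

(** The position of the ridge's last letter in [inf_cons w], with 0 for infinity; as a number it is
    additive when a factor is removed. *)
Definition ridge_last_pos (w : seq nat) : nat :=
  if has (adjacent_leading w) (iota 0 (size w))
  then find (adjacent_leading w) (iota 0 (size w))
  else rightmost_descent_pos w.

Lemma size_ridge (w : seq nat) : size (ridge w) = (ridge_last_pos w).+1.
Proof.
rewrite /ridge /ridge_last_pos; case: ifPn => [has_adj|_];
  rewrite size_takel //= size_map ltnS.
  by move: has_adj; rewrite has_find size_iota => /ltnW.
by apply/bigmax_leqP_seq => y yw _; rewrite index_mem.
Qed.

(** As [x] is a descent, the maximum is at least [(size a).+1]; this also covers a [v] without
    descents, whose own value is the default 0. *)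
Lemma rightmost_descent_pos_cat (a : seq nat) (x : nat) (v : seq nat) :
  uniq (a ++ x :: v) -> descent (a ++ x :: v) x ->
  rightmost_descent_pos (a ++ x :: v) =
    (size a).+1 + rightmost_descent_pos v.
Proof.
move=> Uw dx; have xa := uniq_split Uw.
have idx y : y \in v -> (index y (a ++ x :: v)).+1 = (size a).+1 + (index y v).+1.
  move=> yv; rewrite index_cat /= ifN; last first.
    apply/negP => ya; move: Uw; rewrite cat_uniq => /and3P[_ /hasP[]].
    by exists y; rewrite // in_cons yv orbT.
  rewrite ifN ?addnS ?addSn //.
  by apply: contraNneq (uniq_splitr Uw) => ->.
have dv y : y \in v -> descent (a ++ x :: v) y = descent v y.
  by move=> yv; rewrite -cat_rcons descent_cat // cat_rcons.
apply/anti_leq/andP; split.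
  apply/bigmax_leqP_seq => y; rewrite mem_cat in_cons orbA => /orP[yax|yv] dy.
    rewrite -cat_rcons index_cat mem_rcons in_cons orbC yax.
    rewrite (leq_trans _ (leq_addr _ _)) // -(size_rcons a x) index_mem.
    by rewrite mem_rcons in_cons orbC.
  rewrite idx // leq_add2l.
  by apply: (@leq_bigmax_seq _ _ _ (fun y => (index y v).+1)); rewrite // -dv.
case: (bigmax_attained v (descent v) (fun y => (index y v).+1)) => [E|].
  rewrite /rightmost_descent_pos [in X in X <= _]E addn0 -(index_split v xa).
  by apply: (@leq_bigmax_seq _ _ _ (fun y => (index y _).+1)); rewrite // descent_mem.
move=> [y /andP[yv dy] E]; rewrite /rightmost_descent_pos [in X in X <= _]E -idx //.
apply: (@leq_bigmax_seq _ _ _ (fun y => (index y _).+1)); last by rewrite dv.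
by rewrite mem_cat in_cons yv !orbT.
Qed.

(** The larger descent [x] occurs after [y]. *)
Lemma leading_descent_before (a : seq nat) (x : nat) (v : seq nat) (y : nat) :
  uniq (a ++ x :: v) -> descent (a ++ x :: v) x ->
  (forall z, descent (a ++ x :: v) z -> z <= x) ->
  y \in a -> leading_descent (a ++ x :: v) (Some y) = false.
Proof.
move=> Uw dx max_x ya; apply/negP => /= /andP[dy /allP le_y].
have neq_yx : y != x by apply: contraNneq (uniq_split Uw) => <-.
have /le_y/implyP/(_ dx) le_xy : x \in drop (index y (a ++ x :: v)).+1 (a ++ x :: v).
  rewrite index_cat ya drop_cat; case: ltnP => _; first by rewrite mem_cat mem_head orbT.
  (* Here [y] is the last letter of [a], and the remaining word starts with [x]. *)
  by rewrite (_ : _ - _ = 0) ?mem_head //; apply/eqP; rewrite subn_eq0 index_mem.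
by move: neq_yx; rewrite eqn_leq le_xy max_x.
Qed.

(** The largest descent [x] plays the role that infinity plays before [v]: it is leading, no letter
    of [a] is, and the leading descents in [v] are unchanged. So the search for an adjacent pair
    starts afresh at [x]. *)
Lemma ridge_last_pos_cat (a : seq nat) (x : nat) (v : seq nat) :
  uniq (a ++ x :: v) -> descent (a ++ x :: v) x ->
  (forall z, descent (a ++ x :: v) z -> z <= x) -> a != [::] ->
  ridge_last_pos (a ++ x :: v) = (size a).+1 + ridge_last_pos v.
Proof.
move=> Uw dx max_x a_neq0; set w := a ++ x :: v.
have w_eq : w = rcons a x ++ v by rewrite cat_rcons.
have letter_before i : i < size a -> leading_descent w (letter w i.+1) = false.
  move=> lt_i; rewrite letterS ?size_cat ?ltn_addr // nth_cat lt_i.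
  by rewrite leading_descent_before // mem_nth.
(* For [i = 0] the pair is infinity and the first letter of [a], which exists as [a] is nonempty;
   the other pairs begin inside [a]. *)
have before i : i < (size a).+1 -> adjacent_leading w i = false.
  rewrite /adjacent_leading; case: i => [_|i]; last by move/letter_before->.
  by rewrite letter_before ?andbF // lt0n size_eq0.
have lead_x : leading_descent w (Some x).
  by rewrite /leading_descent dx; apply/allP => z _; apply/implyP/max_x.
have shift_letter i : i <= size v ->
    leading_descent w (letter w ((size a).+1 + i)) = leading_descent v (letter v i).
  case: i => [_|i lt_i].
    by rewrite addn0 letterS ?size_cat /= ?addnS ?leq_addr // nth_cat ltnn subnn.
  rewrite w_eq -(size_rcons a x) letter_cat letterS // leading_descent_cat ?mem_nth //.
  by rewrite -w_eq.
have after i : i < size v ->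
    adjacent_leading w ((size a).+1 + i) = adjacent_leading v i.
  by move=> lt_i; rewrite /adjacent_leading -addnS !shift_letter // ltnW.
rewrite /ridge_last_pos [size w]size_cat /= addnS -addSn iotaD add0n.
rewrite -[X in iota X (size v)]addn0 iotaDl has_cat find_cat size_iota has_map find_map.
have -> : has (adjacent_leading w) (iota 0 (size a).+1) = false.
  by apply/hasPn => i; rewrite mem_iota => /before->.
have E : {in iota 0 (size v), preim (addn (size a).+1) (adjacent_leading w)
           =1 adjacent_leading v}.
  by move=> i; rewrite mem_iota /= => /after.
rewrite orFb (eq_in_has E) (eq_in_find E) rightmost_descent_pos_cat //.
by case: ifP.
Qed.

(** The ridge is infinity alone if the word is increasing, and also if its largest descent [x] comes
    first, as infinity and [x] are then adjacent leading descents; the first letter is [beta1].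
    Otherwise both sides pass to [c :: b]. *)
Lemma letter_right_of_ridge (w : seq nat) : uniq w -> w != [::] ->
  letter w (size (ridge w)) = Some (beta1 w).
Proof.
move=> Uw; rewrite size_ridge; elim/rix_ind: w / Uw.
- move=> w Uw Sw -> w_neq0.
  suff -> : ridge_last_pos w = 0 by case: (w) w_neq0.
  rewrite /ridge_last_pos ifN.
    apply/eqP; rewrite -leqn0; apply/bigmax_leqP_seq => y _.
    by rewrite sorted_no_descent.
  apply/hasPn => i; rewrite mem_iota => /= lt_i.
  by rewrite /adjacent_leading letterS // /= sorted_no_descent ?andbF.
- move=> x c b w Uw lt_cx max_x -> _.
  suff al0 : adjacent_leading w 0 by rewrite /ridge_last_pos /= al0.
  rewrite /adjacent_leading /= -/w (@descent_split [::]) //= lt_cx /=.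
  by apply/allP => z _; apply/implyP/max_x.
move=> a x c b w Uw lt_cx max_x a_neq0 -> /(_ isT) IH _.
have dx : descent w x by rewrite descent_split ?(uniq_split Uw).
rewrite ridge_last_pos_cat // -IH.
by rewrite /w -cat_rcons -addnS -(size_rcons a x) letter_cat.
Qed.

(** * Comparison of beta_1 with a rightmost descent that is not a peak *)

Lemma uniq_split_inj (a b a' b' : seq nat) (x : nat) :
  uniq (a ++ x :: b) -> a ++ x :: b = a' ++ x :: b' -> a = a' /\ b = b'.
Proof.
move=> Uw E; have Uw' := Uw; rewrite E in Uw'.
have sz : size a = size a'.
  by rewrite -(index_split b (uniq_split Uw)) E index_split // (uniq_split Uw').
by move/eqP: E; rewrite eqseq_cat // => /andP[/eqP-> /eqP[->]].
Qed.

(* If the rightmost descent d is not a peak, then it is the second letter of a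
   pair of adjacent leading descents, so that the factorization stops at a
   leading descent at least as large as d. *)
Lemma beta1_ge_nonpeak (w : seq nat) : uniq w ->
  forall a d s, w = a ++ d :: s -> sorted ltn s -> ltx (ohead s) (Some d) ->
  ~~ ltx (last None (map Some a)) (Some d) -> d <= beta1 w.
Proof.
move=> Uw; elim/rix_ind: w / Uw.
- move=> w Uw Sw _ a d s wE _ lt_sd _.
  have := sorted_no_descent d Uw Sw.
  by rewrite wE descent_split ?lt_sd //; move: Uw; rewrite wE => /uniq_split.
- move=> x c b w Uw _ max_x -> a d s wE _ lt_sd _; apply: max_x.
  by rewrite wE descent_split //; move: Uw; rewrite wE => /uniq_split.
move=> a x c b w Uw lt_cx max_x a_neq0 -> IH a' d s wE Ss lt_sd lt_da.
have Uw' := Uw; rewrite wE in Uw'.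
have dx : descent w x by rewrite descent_split ?(uniq_split Uw).
have : x \in a' ++ d :: s by rewrite -wE descent_mem.
rewrite mem_cat in_cons => /or3P[xa'|/eqP xd|xs].
(* The descent [d] lies in the remaining word and is still no peak there: if [a2] is empty, its
   predecessor becomes infinity. *)
- case/splitPr: xa' wE lt_da {Uw'} => a1 a2.
  rewrite -catA cat_cons => wE lt_da; case: (uniq_split_inj Uw wE) => _ vE.
  apply: IH vE Ss lt_sd _.
  by apply: contra lt_da; rewrite map_cat last_cat /=; case: (a2).
(* If [x = d], the letter [e] just before it is larger, hence a descent exceeding the largest
   one. *)
- move: Uw Uw' max_x a_neq0 lt_da wE; rewrite /w -{}xd => Uw Uw' max_x a_neq0 + wE.
  case: (uniq_split_inj Uw wE) => aE _; rewrite -{}aE in wE Uw' *.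
  case/lastP: a a_neq0 Uw max_x {w IH wE dx Uw'} => // a e _ Uw max_x.
  rewrite map_rcons last_rcons /= -leqNgt leq_eqVlt => /orP[/eqP xe|lt_xe].
    by move: (uniq_split Uw); rewrite xe mem_rcons mem_head.
  rewrite cat_rcons in Uw max_x.
  have := max_x e; rewrite descent_split ?(uniq_split Uw) // => /(_ lt_xe).
  by rewrite leqNgt lt_xe.
move: Uw' dx; rewrite wE -cat_rcons => Uw'; rewrite descent_cat //.
by rewrite sorted_no_descent //; move: Uw'; rewrite cat_uniq => /and3P[].
Qed.

(** * The maximal increasing suffix and larger peaks *)

Lemma max_incr_suffix_split (w : seq nat) : exists2 u,
  w = u ++ max_incr_suffix w & sorted ltn (max_incr_suffix w) /\
  forall a d, u = rcons a d -> ~~ sorted ltn (d :: max_incr_suffix w).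
Proof.
elim: w => [|h w [u wE [Ss nS]]].
  by exists [::] => //; split=> // -[].
rewrite [max_incr_suffix _]/=; case: ifPn => Sw.
  by exists [::] => //; split=> // -[].
exists (h :: u); first by rewrite {1}wE.
split=> // a d; case/lastP: u wE nS => [|u e] wE nS.
  (* With [u] empty the suffix is all of [w], and the failed test [Sw] is the claim for [h]. *)
  by case: a => [[<-]|? []//]; rewrite -[max_incr_suffix w]cat0s -wE.
by rewrite -rcons_cons => /rcons_inj[_ <-]; apply: (nS u).
Qed.

Lemma mem_max_incr_suffix (a b : seq nat) (y : nat) :
  sorted ltn (y :: b) -> y \in max_incr_suffix (a ++ y :: b).
Proof.
move=> Syb; elim: a => [|h a IH]; first by rewrite /= ifT ?mem_head.
by rewrite cat_cons [max_incr_suffix _]/= -cat_cons; case: ifP => // _;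
  rewrite mem_cat mem_head orbT.
Qed.

(** Climb from [y] to the right: the climb stops before the end of the word since [y :: b] is not
    increasing, and the letter where it stops is a peak. *)
Lemma larger_peak (a b : seq nat) (y : nat) :
  uniq (a ++ y :: b) -> ltx (Some y) (ohead b) -> ~~ sorted ltn (y :: b) ->
  exists2 z, (z \in b) && (y < z) & peak (a ++ y :: b) z.
Proof.
elim: b a y => // c b IH a y Uw /= lt_yc; rewrite /= lt_yc /= => nS.
have wE : a ++ [:: y, c & b] = rcons a y ++ c :: b by rewrite cat_rcons.
rewrite wE in Uw *.
have [lt_cb|ge_cb] := boolP (ltx (Some c) (ohead b)).
  have [z /andP[zb lt_cz] pz] := IH _ _ Uw lt_cb nS.
  by exists z; rewrite // in_cons zb orbT (ltn_trans lt_yc).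
exists c; rewrite ?mem_head //.
rewrite /peak mem_cat mem_head orbT prev_letter_split ?(uniq_split Uw) //.
rewrite map_rcons last_rcons [ltx _ _]lt_yc next_letter_split ?(uniq_split Uw) //=.
(* An empty [b] would put infinity after [c]; equality is excluded by distinctness. *)
case: b ge_cb Uw {IH nS wE} => [|b0 b] //=; rewrite -leqNgt leq_eqVlt.
by case/orP => // /eqP-> /uniq_splitr; rewrite mem_head.
Qed.

Lemma mem_right_split (a b : seq nat) (y z : nat) :
  uniq (a ++ y :: b) -> z \in a ++ y :: b ->
  (index y (a ++ y :: b) < index z (a ++ y :: b)) = (z \in b).
Proof.
move=> Uw; rewrite index_split ?(uniq_split Uw) // => zw.
have zab : z \in a -> z \notin y :: b.
  move=> za; apply/negP => zb; move: Uw; rewrite cat_uniq => /and3P[_ /hasP[]].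
  by exists z.
rewrite index_cat; case: ifPn => za.
  rewrite ltnNge ltnW ?index_mem //=.
  by move: (zab za); rewrite in_cons => /norP[_ /negbTE->].
rewrite -[X in X < _]addn0 ltn_add2l /= eq_sym.
move: zw; rewrite mem_cat (negbTE za) in_cons; case: eqP => [->|_ /=->] //.
by rewrite ltnn (negbTE (uniq_splitr Uw)).
Qed.

(** The predecessor of [z] still lies in [y :: b]. This rules out peaks and valleys to the right of
    [y]. *)
Lemma sorted_tail_neighbours (a b : seq nat) (y z : nat) :
  uniq (a ++ y :: b) -> sorted ltn (y :: b) -> z \in b ->
  ltx (prev_letter (a ++ y :: b) z) (Some z) /\
  ltx (Some z) (next_letter (a ++ y :: b) z).
Proof.
move=> Uw Syb /splitPr zb; case: zb Uw Syb => b1 b2.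
rewrite -cat_cons catA => Uw.
rewrite prev_letter_split ?next_letter_split ?(uniq_split Uw) //.
rewrite sorted_cat_cons map_cat last_cat /= last_map => /andP[+ p2].
rewrite rcons_path => /andP[_ lt_z]; split=> //.
by case: b2 p2 {Uw} => //= ? ? /andP[].
Qed.

(** * The characterization of rixed points *)

Lemma Rix_characterization (w : seq nat) (n : nat) :
  uniq w -> {in w, forall y, y <= n} ->
  (forall y : nat, y \in Rix w ->
     double_ascent w y \/
     (rightmost_valley w y /\ (first_letter w y \/ follows_peak w y)))
  /\
  (forall y : nat, y \in w ->
     double_ascent w y \/
     (rightmost_valley w y /\ (first_letter w y \/ follows_peak w y)) ->
     (y \in Rix w <->
      forall z : nat, y < z <= n ->
        ~ (right_of_ridge w z \/ (peak w z /\ index y w < index z w)))).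
Proof.
move=> Uw le_n; have [u wE [Ss nS]] := max_incr_suffix_split w.
have ridgeP y : y \in w -> letter w (size (ridge w)) = Some (beta1 w).
  by move=> yw; apply: letter_right_of_ridge => //; case: (w) yw.
split=> y; rewrite mem_filter.
  case/andP=> le_y; move: (max_incr_suffix w) wE Ss nS => s wE Ss nS ys.
  (* A letter of the suffix after its first is a double ascent; the first one is the rightmost
     valley. *)
  case/splitPr: ys wE Ss nS => s1 s2; case: s1 => [|e s1] wE Ss nS; last first.
    left; have yes : y \in s1 ++ y :: s2 by rewrite mem_cat mem_head orbT.
    rewrite wE cat_cons in Uw *.
    have [lt_y gt_y] := sorted_tail_neighbours Uw Ss yes.
    by rewrite /double_ascent lt_y gt_y mem_cat in_cons yes !orbT.
  rewrite cat0s in wE Ss nS; rewrite wE in Uw le_y *; right.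
  have yu := uniq_split Uw.
  have gt_y : ltx (Some y) (ohead s2) by case: (s2) Ss => //= ? ? /andP[].
  (* By maximality of the suffix, the letter before [y], if any, is larger. *)
  have prev_d a d : u = rcons a d -> y < d.
    move=> uE; have := nS a d uE; rewrite /= negb_and [path _ _ _]Ss orbF.
    rewrite -leqNgt leq_eqVlt => /orP[/eqP yd|//].
    by rewrite uE yd mem_rcons mem_head in yu.
  split; first split.
  - rewrite /valley mem_cat mem_head orbT prev_letter_split //.
    rewrite next_letter_split // gt_y andbT /=.
    by case/lastP: (u) prev_d => // a d /(_ _ _ erefl); rewrite map_rcons last_rcons.
  - move=> z /and3P[zw lt_z _]; rewrite leqNgt mem_right_split //.
    apply/negP => /(sorted_tail_neighbours Uw Ss)[+ _].
    by case: (prev_letter _ _) lt_z => //= c /ltn_trans/[apply]; rewrite ltnn.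
  case/lastP: u Uw le_y yu prev_d {wE nS} => [|a d] Uw le_y yu prev_d; first by left.
  have lt_yd := prev_d _ _ erefl; rewrite cat_rcons in Uw le_y *; right.
  exists d; first by rewrite -cat_rcons prev_letter_split // map_rcons last_rcons.
  rewrite /peak mem_cat mem_head orbT prev_letter_split ?(uniq_split Uw) //.
  rewrite next_letter_split ?(uniq_split Uw) //= lt_yd andbT.
  (* Were the rightmost descent [d] no peak, [y < d <= beta1] would contradict [beta1 <= y]. *)
  apply: contraTT le_y => npd; rewrite -ltnNge (leq_trans lt_yd) //.
  exact: (beta1_ge_nonpeak Uw erefl).
move=> yw Cy.
(* In either case [y] is followed by a larger letter, from which a climb to a peak can start. *)
have gt_y : ltx (Some y) (next_letter w y).
  by case: Cy => [/and3P[]|[[/and3P[]]]].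
split=> [/andP[le_y ys] z /andP[lt_yz _]|no_z].
  rewrite /right_of_ridge (ridgeP y) // => -[[zE]|[pz lt_i]].
    by rewrite ltnNge -zE le_y in lt_yz.
  move: (max_incr_suffix w) wE Ss {nS} ys => s wE Ss ys.
  case/splitPr: ys wE Ss => s1 s2; rewrite catA => wE Ss.
  have Syb : sorted ltn (y :: s2) by move: Ss; rewrite sorted_cat_cons => /andP[].
  rewrite wE in Uw lt_i pz; have /and3P[zw _ +] := pz.
  rewrite mem_right_split // in lt_i.
  have [_] := sorted_tail_neighbours Uw Syb lt_i.
  by case: (next_letter _ _) => //= c /ltn_trans/[apply]; rewrite ltnn.
apply/andP; split.
  (* If [y < beta1 w], then [beta1 w] itself is a forbidden letter, being right of the ridge. *)
  rewrite leqNgt; apply/negP => lt_y; apply: (no_z (beta1 w)).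
    by rewrite lt_y le_n // beta1_mem //; case: (w) yw.
  by left; apply: ridgeP yw.
case/splitPr: yw Uw le_n gt_y no_z {wE Ss nS ridgeP Cy} => a b Uw le_n.
rewrite next_letter_split ?(uniq_split Uw) // => gt_y no_z.
(* If the word from [y] on were not increasing, the climb from [y] would reach a forbidden peak. *)
apply: mem_max_incr_suffix; apply: contraT => nS.
have [z /andP[zb lt_yz] pz] := larger_peak Uw gt_y nS.
have zw : z \in a ++ y :: b by rewrite mem_cat in_cons zb !orbT.
case: (no_z z); first by rewrite lt_yz le_n.
by right; rewrite mem_right_split.
Qed.

Theorem theorem15 (n : nat) (p : 'S_n) :
  let w := one_line p in
  (forall y : nat, y \in Rix w ->
     double_ascent w y \/
     (rightmost_valley w y /\ (first_letter w y \/ follows_peak w y)))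
  /\
  (forall y : nat, y \in w ->
     double_ascent w y \/
     (rightmost_valley w y /\ (first_letter w y \/ follows_peak w y)) ->
     (y \in Rix w <->
      forall z : nat, y < z <= n ->
        ~ (right_of_ridge w z \/ (peak w z /\ index y w < index z w)))).
Proof.
apply: Rix_characterization.
  by rewrite map_inj_uniq ?enum_uniq // => i j [/val_inj/perm_inj].
by move=> y /mapP[i _ ->].
Qed.
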